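(* The system $\mathsf P+\mathsf{QF\text{-}AC}^{1,0}$ proves $\mathsf{GH}^{\mathbb a}_{\mathsf{ns}2}\to\Pi^0_1\text{-}\mathsf{TRANS}$.
   Context: Framework. $\mathsf{E\text{-}PA}^{\omega*}$ is Peano arithmetic in all finite types with the axiom of extensionality, with additional types $\rho^*$ of finite sequences; type $0$ = naturals, $1=0\to0$, $2=1\to0$. The language of $\mathsf P$ adds a predicate $\mathrm{st}$ (''standard'') for every type; $(\forall^{\mathrm{st}}x)\varphi\equiv(\forall x)(\mathrm{st}(x)\to\varphi)$, $(\exists^{\mathrm{st}}x)\varphi\equiv(\exists x)(\mathrm{st}(x)\wedge\varphi)$; internal = not containing $\mathrm{st}$. $\mathsf P$ is $\mathsf{E\text{-}PA}^{\omega*}$ plus: (i) $\mathrm{st}(x)\wedge x=y\to\mathrm{st}(y)$; (ii) $\mathrm{st}(t)$ for each closed term $t$; (iii) $\mathrm{st}(f)\wedge\mathrm{st}(x)\to\mathrm{st}(f(x))$; (iv) external induction for every formula; (v) $\mathsf{HAC}_{\mathrm{int}}$: for internal $\varphi$, $(\forall^{\mathrm{st}}x^\rho)(\exists^{\mathrm{st}}y^\tau)\varphi(x,y)\to(\exists^{\mathrm{st}}F^{\rho\to\tau^*})(\forall^{\mathrm{st}}x^\rho)(\exists y\in F(x))\varphi(x,y)$; (vi) idealisation: for internal $\varphi$ with arbitrary parameters, $(\forall^{\mathrm{st}}x^{\sigma^*})(\exists y^\tau)(\forall z^\sigma\in x)\varphi(z,y)\to(\exists y^\tau)(\forall^{\mathrm{st}}x^\sigma)\varphi(x,y)$.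 $\mathsf{QF\text{-}AC}^{1,0}$: for internal quantifier-free $\varphi_0$, $(\forall x^1)(\exists y^0)\varphi_0(x,y)\to(\exists F^2)(\forall x^1)\varphi_0(x,F(x))$. $\gamma\approx_1\varepsilon$ means $(\forall^{\mathrm{st}}n)\gamma(n)=\varepsilon(n)$. Finite sequences of numbers coded by numbers; $*$ concatenation, $\overline\alpha k$ initial segment of length $k$; $\sigma\preceq\tau$ initial segment. Associates: $\gamma^1\in C$ means $(\forall\beta^1)(\exists k)\gamma(\overline\beta k)>0$ and $(\forall\sigma,\tau,n)((\sigma\preceq\tau\wedge\gamma(\overline\sigma n)>0)\to\gamma(\sigma)=\gamma(\tau))$. The value $\gamma(\alpha)$ is $\gamma(\overline\alpha N)-1$ for $N$ with $\gamma(\overline\alpha N)>0$ (using $\mathsf{QF\text{-}AC}^{1,0}$, $\gamma(\alpha):=\gamma(\overline\alpha F(\alpha))-1$ for a choice function $F$). $\mathsf{GH}(\Gamma,\gamma,s)$: $\Gamma(\gamma,s)=\gamma(s*0*(\lambda n^0)\Gamma(\gamma,s*(n+1)))$. $\mathsf{GH}^{\mathbb a}_{\mathsf{ns}2}$: $(\exists^{\mathrm{st}}\Gamma)\big[(\forall^{\mathrm{st}}\gamma^1\in C)(\forall s^0)\mathsf{GH}(\Gamma,\gamma,s)\wedge(\forall^{\mathrm{st}}\gamma^1,\varepsilon^1\in C,s^0)(\gamma\approx_1\varepsilon\to\Gamma(\gamma,s)=_0\Gamma(\varepsilon,s))\big]$. $\Pi^0_1\text{-}\mathsf{TRANS}$: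 $(\forall^{\mathrm{st}}f^1)[(\forall^{\mathrm{st}}n)f(n)=0\to(\forall m)f(m)=0]$. *)

(* Defs.v *)
(* The system P + QF-AC^{1,0} as a deep embedding: simply typed lambda-terms with
   recursors, many-sorted formulas, and classical natural deduction.
   Binding is by intrinsically typed de Bruijn indices. *)
From Stdlib Require Import List.
Import ListNotations.

Set Implicit Arguments.
Unset Strict Implicit.
Unset Printing Implicit Defensive.

(* * Types, terms, formulas *)

Inductive ty : Type :=
| N
| Arr (a b : ty)
| Star (a : ty).

Declare Scope ty_scope.
Delimit Scope ty_scope with ty.
Bind Scope ty_scope with ty.
Notation "a ⇒ b" := (Arr a b) (at level 55, right associativity) : ty_scope.
Notation "a ^*" := (Star a) (at level 2, left associativity, format "a ^*") : ty_scope.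
Local Open Scope ty_scope.

Definition one : ty := N ⇒ N.
Definition two : ty := one ⇒ N.

Definition ctx : Type := list ty.

Inductive var : ctx -> ty -> Type :=
| VZ G a : var (a :: G) a
| VS G a b : var G a -> var (b :: G) a.
Arguments VZ {G a}.
Arguments VS {G a b} v.

Inductive tm : ctx -> ty -> Type :=
| Var G a : var G a -> tm G a
| App G a b : tm G (a ⇒ b) -> tm G a -> tm G b
| Lam G a b : tm (a :: G) b -> tm G (a ⇒ b)
| Zero G : tm G N
| Succ G : tm G (N ⇒ N)
| Rec G a : tm G (N ⇒ a ⇒ (a ⇒ N ⇒ a) ⇒ a)
| Nil G a : tm G (a^*)
| Cons G a : tm G (a ⇒ a^* ⇒ a^*)
| LRec G a b : tm G (a^* ⇒ b ⇒ (b ⇒ a ⇒ a^* ⇒ b) ⇒ b).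
Arguments Var {G a} v.
Arguments App {G a b} t u.
Arguments Lam {G} a {b} t.
Arguments Zero {G}.
Arguments Succ {G}.
Arguments Rec {G a}.
Arguments Nil {G a}.
Arguments Cons {G a}.
Arguments LRec {G a b}.

Inductive fm : ctx -> Type :=
| Eq G a : tm G a -> tm G a -> fm G
| St G a : tm G a -> fm G
| Bot G : fm G
| And G : fm G -> fm G -> fm G
| Or G : fm G -> fm G -> fm G
| Imp G : fm G -> fm G -> fm G
| All G a : fm (a :: G) -> fm G
| Ex G a : fm (a :: G) -> fm G.
Arguments Eq {G a} t u.
Arguments St {G a} t.
Arguments Bot {G}.
Arguments And {G} p q.
Arguments Or {G} p q.
Arguments Imp {G} p q.
Arguments All {G} a p.
Arguments Ex {G} a p.

Definition Neg {G} (p : fm G) : fm G := Imp p Bot.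

(* * Renaming and substitution *)

Definition ren (G D : ctx) : Type := forall a, var G a -> var D a.
Definition sub (G D : ctx) : Type := forall a, var G a -> tm D a.

Definition var_case {G b} (P : ty -> Type) (z : P b) (s : forall a, var G a -> P a)
    a (v : var (b :: G) a) : P a :=
  match v in var E a'
        return match E with
               | [] => unit
               | b' :: G' => P b' -> (forall a, var G' a -> P a) -> P a'
               end with
  | VZ => fun z _ => z
  | VS w => fun _ s => s _ w
  end z s.

Definition up_ren {G D b} (r : ren G D) : ren (b :: G) (b :: D) :=
  var_case (P := var (b :: D)) VZ (fun a v => VS (r a v)).

Fixpoint tren {G a} (t : tm G a) : forall D, ren G D -> tm D a :=
  match t in tm G a return forall D, ren G D -> tm D a with
  | Var v => fun _ r => Var (r _ v)
  | App t u => fun _ r => App (tren t r) (tren u r)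
  | Lam a t => fun _ r => Lam a (tren t (up_ren r))
  | Zero => fun _ _ => Zero
  | Succ => fun _ _ => Succ
  | Rec => fun _ _ => Rec
  | Nil => fun _ _ => Nil
  | Cons => fun _ _ => Cons
  | LRec => fun _ _ => LRec
  end.

Definition wk {G b} : ren G (b :: G) := fun a v => VS v.

Definition scons {G D b} (t : tm D b) (s : sub G D) : sub (b :: G) D :=
  var_case (P := tm D) t s.

Definition up_sub {G D b} (s : sub G D) : sub (b :: G) (b :: D) :=
  scons (Var VZ) (fun a v => tren (s a v) wk).

Fixpoint tsub {G a} (t : tm G a) : forall D, sub G D -> tm D a :=
  match t in tm G a return forall D, sub G D -> tm D a with
  | Var v => fun _ s => s _ v
  | App t u => fun _ s => App (tsub t s) (tsub u s)
  | Lam a t => fun _ s => Lam a (tsub t (up_sub s))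
  | Zero => fun _ _ => Zero
  | Succ => fun _ _ => Succ
  | Rec => fun _ _ => Rec
  | Nil => fun _ _ => Nil
  | Cons => fun _ _ => Cons
  | LRec => fun _ _ => LRec
  end.

Fixpoint fsub {G} (p : fm G) : forall D, sub G D -> fm D :=
  match p in fm G return forall D, sub G D -> fm D with
  | Eq t u => fun _ s => Eq (tsub t s) (tsub u s)
  | St t => fun _ s => St (tsub t s)
  | Bot => fun _ _ => Bot
  | And p q => fun _ s => And (fsub p s) (fsub q s)
  | Or p q => fun _ s => Or (fsub p s) (fsub q s)
  | Imp p q => fun _ s => Imp (fsub p s) (fsub q s)
  | All a p => fun _ s => All a (fsub p (up_sub s))
  | Ex a p => fun _ s => Ex a (fsub p (up_sub s))
  end.

Definition ids {G} : sub G G := fun a v => Var v.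

Definition tsub1 {G a b} (t : tm (b :: G) a) (u : tm G b) : tm G a := tsub t (scons u ids).
Definition fsub1 {G b} (p : fm (b :: G)) (u : tm G b) : fm G := fsub p (scons u ids).
Definition fwk {G b} (p : fm G) : fm (b :: G) := fsub p (fun a v => Var (VS v)).

(* * Named binders

   [∀[a] x, p], [∃[a] x, p] and [λ[a] x, t] bind a Rocq variable [x] standing for the
   bound object variable; its occurrences below further binders are weakened by
   instance resolution on [Ext], and [↑ t] weakens an arbitrary term in the same way.
   All of this reduces to plain de Bruijn syntax. *)

Class Ext (G D : ctx) : Type := ext : ren G D.
#[export] Instance Ext_refl G : Ext G G | 0 := fun a v => v.
#[export] Instance Ext_cons G D b (e : Ext G D) : Ext G (b :: D) | 1 := fun a v => VS (e a v).

(* A one-point type: [G] and [a] already determine the variable meant, index 0 of [a :: G]. *)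
Inductive bound (G : ctx) (a : ty) : Type := Bound.
Arguments Bound {G a}.

Definition use {G a D} {e : Ext (a :: G) D} (x : bound G a) : tm D a := Var (e a VZ).
#[warning="-uniform-inheritance"] Coercion use : bound >-> tm.

Definition lam_ {G} a {b} (f : bound G a -> tm (a :: G) b) : tm G (a ⇒ b) :=
  Lam a (f Bound).
Definition all_ {G} a (f : bound G a -> fm (a :: G)) : fm G := All a (f Bound).
Definition ex_ {G} a (f : bound G a -> fm (a :: G)) : fm G := Ex a (f Bound).
Arguments lam_ {G} a {b} f.
Arguments all_ {G} a f.
Arguments ex_ {G} a f.

Definition lift {G D a} {e : Ext G D} (t : tm G a) : tm D a := tren t e.

(* [p] has one (resp. two) distinguished variables over the parameter context [G];
   [inst1 p t] is p(t), [inst2 p t u] is p(t, u), with [u] for the innermost one. *)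
Definition inst1 {G D a} {e : Ext G D} (p : fm (a :: G)) (t : tm D a) : fm D :=
  fsub p (scons t (fun c v => Var (e c v))).
Definition inst2 {G D a b} {e : Ext G D} (p : fm (b :: a :: G)) (t : tm D a) (u : tm D b) : fm D :=
  fsub p (scons u (scons t (fun c v => Var (e c v)))).

Declare Scope obj_scope.
Delimit Scope obj_scope with obj.
Bind Scope obj_scope with tm.
Bind Scope obj_scope with fm.
Local Open Scope obj_scope.

Notation "f · t" := (App f t) (at level 40, left associativity) : obj_scope.
Notation "↑ t" := (lift t) (at level 9, t at level 9, format "↑ t") : obj_scope.
Notation "λ[ a ] x , t" := (lam_ a (fun x => t))
  (at level 200, a at level 100, x name, t at level 200, format "λ[ a ]  x ,  t") : obj_scope.
Notation "t ≐ u" := (Eq t u) (at level 70, no associativity) : obj_scope.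
Notation "¬ p" := (Neg p) (at level 75, right associativity) : obj_scope.
Notation "p ∧ q" := (And p q) (at level 80, right associativity) : obj_scope.
Notation "p ∨ q" := (Or p q) (at level 85, right associativity) : obj_scope.
Notation "p ⟶ q" := (Imp p q) (at level 95, right associativity) : obj_scope.
Notation "∀[ a ] x , p" := (all_ a (fun x => p))
  (at level 200, a at level 100, x name, p at level 200, format "∀[ a ]  x ,  p") : obj_scope.
Notation "∃[ a ] x , p" := (ex_ a (fun x => p))
  (at level 200, a at level 100, x name, p at level 200, format "∃[ a ]  x ,  p") : obj_scope.
Notation "∀st[ a ] x , p" := (all_ a (fun x => Imp (St (use x)) p))
  (at level 200, a at level 100, x name, p at level 200, format "∀st[ a ]  x ,  p") : obj_scope.
Notation "∃st[ a ] x , p" := (ex_ a (fun x => And (St (use x)) p))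
  (at level 200, a at level 100, x name, p at level 200, format "∃st[ a ]  x ,  p") : obj_scope.

(* * Closed terms of arithmetic and of finite sequences *)

Definition pred_tm {G} : tm G (N ⇒ N) := λ[N] n, Rec · n · Zero · (λ[N] _, λ[N] m, m).

Definition monus {G} : tm G (N ⇒ N ⇒ N) :=
  λ[N] m, λ[N] n, Rec · n · m · (λ[N] r, λ[N] _, pred_tm · r).

(* Quantifier-free, as < has to be for QF-AC. *)
Definition lt_fm {G} (t u : tm G N) : fm G := monus · (Succ · t) · u ≐ Zero.
Notation "t < u" := (lt_fm t u) (at level 70, no associativity) : obj_scope.

Definition len {G a} : tm G (a^* ⇒ N) :=
  λ[a^*] l, LRec · l · Zero · (λ[N] r, λ[a] _, λ[a^*] _, Succ · r).

Definition cat {G a} : tm G (a^* ⇒ a^* ⇒ a^*) :=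
  λ[a^*] l, λ[a^*] k, LRec · l · k · (λ[a^*] r, λ[a] x, λ[a^*] _, Cons · x · r).

Fixpoint dflt (a : ty) : forall G, tm G a :=
  match a with
  | N => fun _ => Zero
  | a ⇒ b => fun G => Lam a (dflt b (a :: G))
  | a^* => fun _ => Nil
  end.

Definition elem_at {G a} : tm G (a^* ⇒ N ⇒ a) :=
  λ[a^*] l, LRec · l · (λ[N] _, dflt a _)
    · (λ[N ⇒ a] r, λ[a] x, λ[a^*] _, λ[N] i, Rec · i · x · (λ[a] _, λ[N] j, r · j)).

Definition take {G a} : tm G (N ⇒ a^* ⇒ a^*) :=
  λ[N] n, λ[a^*] l, LRec · l · (λ[N] _, Nil)
    · (λ[N ⇒ a^*] r, λ[a] x, λ[a^*] _, λ[N] m,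
         Rec · m · Nil · (λ[a^*] _, λ[N] j, Cons · x · (r · j))) · n.

(* [tab · f · k] = <f 0, ..., f (k - 1)>. *)
Definition tab {G a} : tm G ((N ⇒ a) ⇒ N ⇒ a^*) :=
  λ[N ⇒ a] f, λ[N] k, Rec · k · (λ[N ⇒ a] _, Nil)
    · (λ[(N ⇒ a) ⇒ a^*] r, λ[N] _, λ[N ⇒ a] g,
         Cons · (g · Zero) · (r · (λ[N] n, g · (Succ · n)))) · f.

(* [prepend · l · f] is the infinite sequence l * f. *)
Definition prepend {G a} : tm G (a^* ⇒ (N ⇒ a) ⇒ (N ⇒ a)) :=
  λ[a^*] l, λ[N ⇒ a] f, LRec · l · f
    · (λ[N ⇒ a] r, λ[a] x, λ[a^*] _, λ[N] i, Rec · i · x · (λ[a] _, λ[N] j, r · j)).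

Definition mem {G a} (x : tm G a) (l : tm G (a^*)) : fm G :=
  ∃[N] i, (i < len · ↑l) ∧ elem_at · ↑l · i ≐ ↑x.
Notation "x ∈ l" := (mem x l) (at level 70, no associativity) : obj_scope.

(* Finite sequences of numbers are coded by the bijection
     code <> = 0,   code (<x> * l) = 2^x (2 code l + 1).
   [nxt] is the successor of N transported to N^* along it, so that
   [decode · n] = nxt^n <> is the inverse of [code]. *)
Definition dbl {G} : tm G (N ⇒ N) :=
  λ[N] n, Rec · n · Zero · (λ[N] r, λ[N] _, Succ · (Succ · r)).

Definition code {G} : tm G (N^* ⇒ N) :=
  λ[N^*] l, LRec · l · Zero
    · (λ[N] r, λ[N] x, λ[N^*] _, Rec · x · (Succ · (dbl · r)) · (λ[N] q, λ[N] _, dbl · q)).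

Definition inc_head {G} : tm G (N^* ⇒ N^*) :=
  λ[N^*] l, LRec · l · Nil · (λ[N^*] _, λ[N] x, λ[N^*] k, Cons · (Succ · x) · k).

Definition nxt {G} : tm G (N^* ⇒ N^*) :=
  λ[N^*] l, LRec · l · (Cons · Zero · Nil)
    · (λ[N^*] r, λ[N] x, λ[N^*] k,
         Rec · x · (inc_head · r) · (λ[N^*] _, λ[N] y, Cons · Zero · (Cons · y · k))).

Definition decode {G} : tm G (N ⇒ N^*) :=
  λ[N] n, Rec · n · Nil · (λ[N^*] r, λ[N] _, nxt · r).

(* * The system P *)

Fixpoint internal {G} (p : fm G) : Prop :=
  match p with
  | Eq _ _ | Bot => True
  | St _ => False
  | And p q | Or p q | Imp p q => internal p /\ internal q
  | All _ p | Ex _ p => internal p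
  end.

(* Only equations of type 0 count as quantifier-free: in the usual presentation
   equality is primitive at type 0 only, and f = g at a function type abbreviates a
   universal formula. *)
Fixpoint quantifier_free {G} (p : fm G) : Prop :=
  match p with
  | @Eq _ a _ _ => a = N
  | Bot => True
  | St _ => False
  | And p q | Or p q | Imp p q => quantifier_free p /\ quantifier_free q
  | All _ _ | Ex _ _ => False
  end.

(* Axioms may contain free variables (parameters) from the context. *)
Definition theory : Type := forall G : ctx, fm G -> Prop.

Inductive E_PA_omega_star : theory :=
| ax_refl G a (t : tm G a) : E_PA_omega_star (t ≐ t)
| ax_leibniz G a (p : fm (a :: G)) (t u : tm G a) :
    internal p -> E_PA_omega_star (t ≐ u ⟶ inst1 p t ⟶ inst1 p u)
| ax_ext G a b (f g : tm G (a ⇒ b)) :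
    E_PA_omega_star ((∀[a] x, ↑f · x ≐ ↑g · x) ⟶ f ≐ g)
| ax_beta G a b (t : tm (a :: G) b) (u : tm G a) :
    E_PA_omega_star (Lam a t · u ≐ tsub1 t u)
| ax_succ_neq0 G (n : tm G N) : E_PA_omega_star (¬ Succ · n ≐ Zero)
| ax_succ_inj G (n m : tm G N) : E_PA_omega_star (Succ · n ≐ Succ · m ⟶ n ≐ m)
| ax_rec0 G a (y : tm G a) (z : tm G (a ⇒ N ⇒ a)) :
    E_PA_omega_star (Rec · Zero · y · z ≐ y)
| ax_recS G a (n : tm G N) (y : tm G a) (z : tm G (a ⇒ N ⇒ a)) :
    E_PA_omega_star (Rec · (Succ · n) · y · z ≐ z · (Rec · n · y · z) · n)
| ax_lrec_nil G a b (y : tm G b) (z : tm G (b ⇒ a ⇒ a^* ⇒ b)) :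
    E_PA_omega_star (LRec · Nil · y · z ≐ y)
| ax_lrec_cons G a b (x : tm G a) (l : tm G (a^*)) (y : tm G b) (z : tm G (b ⇒ a ⇒ a^* ⇒ b)) :
    E_PA_omega_star (LRec · (Cons · x · l) · y · z ≐ z · (LRec · l · y · z) · x · l)
| ax_seq G a (l : tm G (a^*)) :
    E_PA_omega_star (l ≐ Nil ∨ (∃[a] x, ∃[a^*] k, ↑l ≐ Cons · x · k))
| ax_ind G (p : fm (N :: G)) :
    internal p ->
    E_PA_omega_star
      (inst1 p Zero ∧ (∀[N] n, inst1 p n ⟶ inst1 p (Succ · n)) ⟶ ∀[N] n, inst1 p n).

Inductive P_system : theory :=
| ax_internal G (p : fm G) : E_PA_omega_star p -> P_system p
| ax_st_eq G a (x y : tm G a) : P_system (St x ∧ x ≐ y ⟶ St y)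
| ax_st_closed G a (t : tm [] a) :
    P_system (St (tren t (fun b v => match v : var [] b with end) : tm G a))
| ax_st_app G a b (f : tm G (a ⇒ b)) (x : tm G a) : P_system (St f ∧ St x ⟶ St (f · x))
| ax_ext_ind G (p : fm (N :: G)) :
    P_system
      (inst1 p Zero ∧ (∀st[N] n, inst1 p n ⟶ inst1 p (Succ · n)) ⟶ ∀st[N] n, inst1 p n)
| ax_HAC_int G a b (p : fm (b :: a :: G)) :
    internal p ->
    P_system
      ((∀st[a] x, ∃st[b] y, inst2 p x y)
       ⟶ ∃st[a ⇒ b^*] F, ∀st[a] x, ∃[b] y, y ∈ F · x ∧ inst2 p x y)
| ax_idealisation G a b (p : fm (b :: a :: G)) :
    internal p ->
    P_system
      ((∀st[a^*] x, ∃[b] y, ∀[a] z, z ∈ x ⟶ inst2 p z y)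
       ⟶ ∃[b] y, ∀st[a] x, inst2 p x y).

Inductive QF_AC_1_0 : theory :=
| ax_QF_AC G (p : fm (N :: one :: G)) :
    quantifier_free p ->
    QF_AC_1_0 ((∀[one] x, ∃[N] y, inst2 p x y) ⟶ ∃[two] F, ∀[one] x, inst2 p x (F · x)).

Definition theory_union (S T : theory) : theory := fun G p => S G p \/ T G p.

(* Classical natural deduction over the axioms [T], in context [G] and from
   hypotheses [H]. *)
Inductive prf (T : theory) : forall G, list (fm G) -> fm G -> Prop :=
| prf_ax G H (p : fm G) : T G p -> prf T H p
| prf_hyp G H (p : fm G) : In p H -> prf T H p
| prf_impI G H (p q : fm G) : prf T (p :: H) q -> prf T H (p ⟶ q)
| prf_impE G H (p q : fm G) : prf T H (p ⟶ q) -> prf T H p -> prf T H q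
| prf_andI G H (p q : fm G) : prf T H p -> prf T H q -> prf T H (p ∧ q)
| prf_andE1 G H (p q : fm G) : prf T H (p ∧ q) -> prf T H p
| prf_andE2 G H (p q : fm G) : prf T H (p ∧ q) -> prf T H q
| prf_orI1 G H (p q : fm G) : prf T H p -> prf T H (p ∨ q)
| prf_orI2 G H (p q : fm G) : prf T H q -> prf T H (p ∨ q)
| prf_orE G H (p q r : fm G) :
    prf T H (p ∨ q) -> prf T (p :: H) r -> prf T (q :: H) r -> prf T H r
| prf_raa G H (p : fm G) : prf T (Neg p :: H) Bot -> prf T H p
| prf_allI G H a (p : fm (a :: G)) : prf T (map fwk H) p -> prf T H (All a p)
| prf_allE G H a (p : fm (a :: G)) (t : tm G a) : prf T H (All a p) -> prf T H (fsub1 p t)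
| prf_exI G H a (p : fm (a :: G)) (t : tm G a) : prf T H (fsub1 p t) -> prf T H (Ex a p)
| prf_exE G H a (p : fm (a :: G)) (q : fm G) :
    prf T H (Ex a p) -> prf T (p :: map fwk H) (fwk q) -> prf T H q.

Definition proves (T : theory) (p : fm []) : Prop := prf T [] p.

(* * The Gandy-Hyland functional for associates *)

(* Initial segments of infinite sequences, and of (codes of) finite ones. *)
Definition initseg {G} (f : tm G one) (k : tm G N) : tm G N := code · (tab · f · k).
Definition initseg_code {G} (s : tm G N) (n : tm G N) : tm G N :=
  code · (take · n · (decode · s)).

Definition prefix {G} (s t : tm G N) : fm G :=
  ∃[N^*] l, cat · (decode · ↑s) · l ≐ decode · ↑t.
Notation "s ⪯ t" := (prefix s t) (at level 70, no associativity) : obj_scope.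

(* s * <x>, for a code s and a number x. *)
Definition snoc {G} (s x : tm G N) : tm G N :=
  code · (cat · (decode · s) · (Cons · x · Nil)).

(* s * f, for a code s and an infinite sequence f. *)
Definition prefixed {G} (s : tm G N) (f : tm G one) : tm G one := prepend · (decode · s) · f.

Definition approx1 {G} (g e : tm G one) : fm G := ∀st[N] n, ↑g · n ≐ ↑e · n.

Definition associate {G} (g : tm G one) : fm G :=
  (∀[one] b, ∃[N] k, Zero < ↑g · initseg b k)
  ∧ (∀[N] s, ∀[N] t, ∀[N] n,
       s ⪯ t ∧ (Zero < ↑g · initseg_code s n) ⟶ ↑g · s ≐ ↑g · t).

(* v = g(f), the value at f of the associate g.  The value does not depend on the n
   with g(f|n) > 0, so no choice function has to be named. *)
Definition value_is {G} (g f : tm G one) (v : tm G N) : fm G :=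
  ∃[N] n, (Zero < ↑g · initseg ↑f n) ∧ ↑v ≐ monus · (↑g · initseg ↑f n) · (Succ · Zero).

Definition GH {G} (Gam : tm G (one ⇒ N ⇒ N)) (g : tm G one) (s : tm G N) : fm G :=
  value_is g
    (prefixed (snoc s Zero) (λ[N] n, ↑Gam · ↑g · snoc ↑s (Succ · n)))
    (Gam · g · s).

Definition GH_a_ns2 : fm [] :=
  ∃st[one ⇒ N ⇒ N] Gam,
    (∀st[one] g, associate g ⟶ ∀[N] s, GH Gam g s)
    ∧ (∀st[one] g, ∀st[one] e, associate g ⟶ associate e ⟶ ∀st[N] s,
         approx1 g e ⟶ Gam · g · s ≐ Gam · e · s).

Definition Pi01_TRANS : fm [] :=
  ∀st[one] f, (∀st[N] n, f · n ≐ Zero) ⟶ ∀[N] m, f · m ≐ Zero.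

(* Main.v *)
(** Suppose a standard [f] vanishes at all standard numbers but [f m <> 0].  For a
    number [c] let [γ_c] send a code [s] to [c] if [f i <> 0] for some [i] below the
    length of [s], and to [0] otherwise.  For [c > 0] this is an associate, of the
    functional with constant value [c - 1], because [f m <> 0] makes every long enough
    sequence yield [c].  On standard [s] it is [0], so [γ_1 ≈ γ_2], and both are
    standard.  Hence [Γ(γ_1, <>) = Γ(γ_2, <>)], whereas the defining equation of [Γ]
    gives the values [0] and [1].

    In the object theory the test "[f i <> 0] for some [i < len l]" is the recursion
    [probe] on [l], which shifts [f] at each step, so that no addition is needed. *)
Require Import Defs.
From Stdlib Require Import List FunctionalExtensionality Setoid Morphisms.
Import ListNotations.

Set Implicit Arguments.
Unset Strict Implicit.
Unset Printing Implicit Defensive.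
Local Open Scope ty_scope.
Local Open Scope obj_scope.

(** * Substitution calculus for terms and formulas *)

Lemma var_cons_ind G b (P : forall a, var (b :: G) a -> Prop) :
  P b VZ -> (forall a (v : var G a), P a (VS v)) -> forall a v, P a v.
Proof.
  intros hz hs a v.
  (* The index [b :: G] is generalised to an arbitrary context [E]; the empty context receives the
     dummy goal [True]. *)
  refine (match v as v' in var E a' return
    match E as E return var E a' -> Prop with
    | [] => fun _ => True
    | b' :: G' => fun v' => forall P : forall a, var (b' :: G') a -> Prop,
        P b' VZ -> (forall a (v : var G' a), P a (VS v)) -> P a' v'
    end v' with
  | VZ => fun P hz _ => hz
  | VS w => fun P _ hs => hs _ w
  end P hz hs).
Qed.

(** Serves renamings and substitutions alike, through the family [P]: below a binder, agreement on
    the new variable and on the old ones gives equality as functions. *)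
Lemma cons_funext G b (P : ty -> Type) (s s' : forall a, var (b :: G) a -> P a) :
  s b VZ = s' b VZ -> (forall a (v : var G a), s a (VS v) = s' a (VS v)) -> s = s'.
Proof.
  intros hz hs. apply functional_extensionality_dep; intro a.
  apply functional_extensionality; intro v. revert a v.
  now apply var_cons_ind.
Qed.

(** The composition laws come in stages, because passing a binder weakens the substitution:
    [tren_tsub] rests on [tren_tren], and [tsub_tsub] on both mixed laws. *)
Lemma tren_tren G a (t : tm G a) D (r : ren G D) E (r' : ren D E) :
  tren (tren t r) r' = tren t (fun b v => r' b (r b v)).
Proof.
  revert D r E r'; induction t; intros; cbn; f_equal; auto.
  rewrite IHt. f_equal. now apply (cons_funext (P := var (a :: E))).
Qed.

Lemma tsub_tren G a (t : tm G a) D (r : ren G D) E (s : sub D E) :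
  tsub (tren t r) s = tsub t (fun b v => s b (r b v)).
Proof.
  revert D r E s; induction t; intros; cbn; f_equal; auto.
  rewrite IHt. f_equal. now apply (cons_funext (P := tm (a :: E))).
Qed.

Lemma tren_tsub G a (t : tm G a) D (s : sub G D) E (r : ren D E) :
  tren (tsub t s) r = tsub t (fun b v => tren (s b v) r).
Proof.
  revert D s E r; induction t; intros; cbn; f_equal; auto.
  rewrite IHt. f_equal. apply (cons_funext (P := tm (a :: E))); [reflexivity|].
  intros c v; cbn. now rewrite !tren_tren.
Qed.

Lemma up_sub_comp G D E b (s : sub G D) (s' : sub D E) :
  (fun a v => tsub (up_sub (b := b) s v) (up_sub s'))
  = up_sub (fun a v => tsub (s a v) s').
Proof.
  apply (cons_funext (P := tm (b :: E))); [reflexivity|].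
  intros c v; cbn. now rewrite tsub_tren, tren_tsub.
Qed.

Lemma tsub_tsub G a (t : tm G a) D (s : sub G D) E (s' : sub D E) :
  tsub (tsub t s) s' = tsub t (fun b v => tsub (s b v) s').
Proof.
  revert D s E s'; induction t; intros; cbn; f_equal; auto.
  now rewrite IHt, up_sub_comp.
Qed.

Lemma fsub_fsub G (p : fm G) D (s : sub G D) E (s' : sub D E) :
  fsub (fsub p s) s' = fsub p (fun b v => tsub (s b v) s').
Proof.
  revert D s E s'; induction p; intros; cbn; f_equal; auto using tsub_tsub;
    now rewrite IHp, up_sub_comp.
Qed.

Lemma up_sub_ids G b : up_sub (b := b) (@ids G) = ids.
Proof. now apply (cons_funext (P := tm (b :: G))). Qed.

Lemma tsub_ids G a (t : tm G a) : tsub t ids = t.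
Proof. induction t; cbn; f_equal; auto. now rewrite up_sub_ids. Qed.

Lemma fsub_ids G (p : fm G) : fsub p ids = p.
Proof. induction p; cbn; f_equal; auto using tsub_ids; now rewrite up_sub_ids. Qed.

Lemma tsub_wk_scons G D a b (t : tm G a) (u : tm D b) (s : sub G D) :
  tsub (tren t wk) (scons u s) = tsub t s.
Proof. apply tsub_tren. Qed.

Lemma tren_as_tsub G a (t : tm G a) D (r : ren G D) :
  tren t r = tsub t (fun b v => Var (r b v)).
Proof. now rewrite <- (tsub_ids (tren t r)), tsub_tren. Qed.

Lemma tren_wk_up G D a b (t : tm G a) (r : ren G D) :
  tren (tren t wk) (up_ren (b := b) r) = tren (tren t r) wk.
Proof. now rewrite !tren_tren. Qed.

Lemma tsub_wk_up G D a b (t : tm G a) (s : sub G D) :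
  tsub (tren t wk) (up_sub (b := b) s) = tren (tsub t s) wk.
Proof. rewrite tsub_tren, tren_tsub. reflexivity. Qed.

Lemma internal_fsub G (p : fm G) D (s : sub G D) : internal p -> internal (fsub p s).
Proof. revert D s; induction p; cbn; intuition. Qed.

(** * Derived rules and provable equality *)

Local Notation P_QF := (theory_union P_system QF_AC_1_0).
Local Notation "H ⊢ p" := (prf P_QF H p) (at level 97, p at level 96).

Local Notation v0 := (Var VZ).
Local Notation v1 := (Var (VS VZ)).
Local Notation v2 := (Var (VS (VS VZ))).
Local Notation v3 := (Var (VS (VS (VS VZ)))).
Local Notation v4 := (Var (VS (VS (VS (VS VZ))))).
Local Notation v6 := (Var (VS (VS (VS (VS (VS (VS VZ))))))).

Section Rules.
Context {G : ctx} {H : list (fm G)}.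

Lemma internal_axiom (p : fm G) : E_PA_omega_star p -> H ⊢ p.
Proof. intro h. apply prf_ax. left. now apply ax_internal. Qed.

Lemma cut (p q : fm G) : H ⊢ p -> p :: H ⊢ q -> H ⊢ q.
Proof. intros hp hq. eapply prf_impE; [apply prf_impI, hq | exact hp]. Qed.

Lemma exfalso_rule (p : fm G) : H ⊢ Bot -> H ⊢ p.
Proof.
  intro h. apply (prf_impE (p := Bot)); [|exact h].
  apply prf_impI, prf_raa, prf_hyp. right; now left.
Qed.

Lemma leibniz a (p : fm (a :: G)) (t u : tm G a) :
  internal p -> H ⊢ t ≐ u -> H ⊢ fsub1 p t -> H ⊢ fsub1 p u.
Proof.
  intros hp e ht. eapply prf_impE; [eapply prf_impE|exact ht]; [|exact e].
  now apply internal_axiom, ax_leibniz.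
Qed.
End Rules.

(** Provable equality as a binary relation, so that object-level equations can drive setoid
    rewriting. *)
Definition eqv {G} (H : list (fm G)) {a} (t u : tm G a) : Prop := H ⊢ t ≐ u.

Section Equality.
Context {G : ctx} {H : list (fm G)}.

Lemma fsub1_eq_l a b (f : tm (b :: G) a) (w : tm G a) (u : tm G b) :
  fsub1 (Eq f (tren w wk)) u = Eq (tsub1 f u) w.
Proof.
  unfold fsub1, tsub1; cbn. now rewrite tsub_wk_scons, tsub_ids.
Qed.

(** Leibniz's law is applied to formulas [x ≐ w] with [w] fixed. Symmetry comes first, since
    transitivity reverses its first equation. *)
#[export] Instance eqv_equiv a : Equivalence (@eqv G H a).
Proof.
  assert (sym : forall t u : tm G a, eqv H t u -> eqv H u t).
  { intros t u e. change (H ⊢ tsub1 v0 u ≐ t).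
    rewrite <- (fsub1_eq_l (b := a) v0 t).
    apply (leibniz (t := t)); [exact I|exact e|].
    rewrite fsub1_eq_l. apply internal_axiom, ax_refl. }
  split.
  - intro t. apply internal_axiom, ax_refl.
  - exact sym.
  - intros t u w e e'. apply sym in e. change (H ⊢ tsub1 v0 t ≐ w).
    rewrite <- (fsub1_eq_l (b := a) v0 w).
    apply (leibniz (t := u)); [exact I|exact e|].
    rewrite fsub1_eq_l. exact e'.
Qed.

(** One side changes at a time: Leibniz's law for [x · t ≐ g · t] in [x], then for
    [g · x ≐ g · u]. *)
#[export] Instance App_proper a b :
  Proper (eqv H ==> eqv H ==> eqv H) (@App G a b).
Proof.
  intros f g ef t u et. transitivity (g · t).
  - unfold eqv. pose proof (fsub1_eq_l (b := a ⇒ b) (v0 · tren t wk) (g · t)) as E.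
    assert (Ef : forall h : tm G (a ⇒ b), tsub1 (v0 · tren t wk) h = h · t).
    { intro h. unfold tsub1; cbn. now rewrite tsub_wk_scons, tsub_ids. }
    rewrite <- (Ef f), <- E.
    apply (leibniz (t := g)); [exact I|now apply eqv_equiv|].
    rewrite E, Ef. apply internal_axiom, ax_refl.
  - unfold eqv. pose proof (fsub1_eq_l (b := a) (tren g wk · v0) (g · u)) as E.
    assert (Eu : forall h : tm G a, tsub1 (tren g wk · v0) h = g · h).
    { intro h. unfold tsub1; cbn. now rewrite tsub_wk_scons, tsub_ids. }
    rewrite <- (Eu t), <- E.
    apply (leibniz (t := u)); [exact I|now apply eqv_equiv|].
    rewrite E, Eu. apply internal_axiom, ax_refl.
Qed.

Lemma beta a b (t : tm (a :: G) b) (u : tm G a) : eqv H (Lam a t · u) (tsub1 t u).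
Proof. apply internal_axiom, ax_beta. Qed.

Lemma rec0 a (y : tm G a) z : eqv H (Rec · Zero · y · z) y.
Proof. apply internal_axiom, ax_rec0. Qed.
Lemma recS a n (y : tm G a) z :
  eqv H (Rec · (Succ · n) · y · z) (z · (Rec · n · y · z) · n).
Proof. apply internal_axiom, ax_recS. Qed.
Lemma lrec_nil a b (y : tm G b) (z : tm G (b ⇒ a ⇒ a^* ⇒ b)) :
  eqv H (LRec · Nil · y · z) y.
Proof. apply internal_axiom, ax_lrec_nil. Qed.
Lemma lrec_cons a b x l (y : tm G b) (z : tm G (b ⇒ a ⇒ a^* ⇒ b)) :
  eqv H (LRec · (Cons · x · l) · y · z) (z · (LRec · l · y · z) · x · l).
Proof. apply internal_axiom, ax_lrec_cons. Qed.
End Equality.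

(** * The scan [probe] and the computation rules of the closed terms *)

Definition shift {G} : tm G (one ⇒ one) := λ[one] f, λ[N] n, f · (Succ · n).

(* [probe · c · l · f] is [c] if [f i <> 0] for some [i < len l], and [0] otherwise. *)
Definition probe {G} : tm G (N ⇒ N^* ⇒ one ⇒ N) :=
  λ[N] c, λ[N^*] l, LRec · l · (λ[one] _, Zero)
    · (λ[one ⇒ N] r, λ[N] _, λ[N^*] _, λ[one] f,
         Rec · (f · Zero) · (r · (shift · f)) · (λ[N] _, λ[N] _, c)).

(** The [γ_c] of the overview. As a closed term applied to [f] and [c], it is standard whenever
    these are. *)
Definition probe_assoc {G} : tm G (one ⇒ N ⇒ one) :=
  λ[one] f, λ[N] c, λ[N] s, probe · c · (decode · s) · f.

Section ClosedTerms.
Context {G D : ctx} (s : sub G D) (a : ty).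
(** Used as rewrite rules, these move a substitution past a closed term without unfolding it. *)
Lemma tsub_len : tsub (@len G a) s = len. Proof. reflexivity. Qed.
Lemma tsub_cat : tsub (@cat G a) s = cat. Proof. reflexivity. Qed.
Lemma tsub_take : tsub (@take G a) s = take. Proof. reflexivity. Qed.
Lemma tsub_tab : tsub (@tab G a) s = tab. Proof. reflexivity. Qed.
Lemma tsub_code : tsub (@code G) s = code. Proof. reflexivity. Qed.
Lemma tsub_dbl : tsub (@dbl G) s = dbl. Proof. reflexivity. Qed.
Lemma tsub_inc_head : tsub (@inc_head G) s = inc_head. Proof. reflexivity. Qed.
Lemma tsub_nxt : tsub (@nxt G) s = nxt. Proof. reflexivity. Qed.
Lemma tsub_decode : tsub (@decode G) s = decode. Proof. reflexivity. Qed.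
Lemma tsub_monus : tsub (@monus G) s = monus. Proof. reflexivity. Qed.
Lemma tsub_pred_tm : tsub (@pred_tm G) s = pred_tm. Proof. reflexivity. Qed.
Lemma tsub_shift : tsub (@shift G) s = shift. Proof. reflexivity. Qed.
Lemma tsub_probe : tsub (@probe G) s = probe. Proof. reflexivity. Qed.
Lemma tsub_probe_assoc : tsub (@probe_assoc G) s = probe_assoc. Proof. reflexivity. Qed.
End ClosedTerms.
#[local] Hint Rewrite @tsub_len @tsub_cat @tsub_take @tsub_tab @tsub_code @tsub_dbl
  @tsub_inc_head @tsub_nxt @tsub_decode @tsub_monus @tsub_pred_tm @tsub_shift
  @tsub_probe @tsub_probe_assoc @tsub_wk_scons @tsub_wk_up @tren_wk_up @tsub_ids : tsub.

Ltac tsimp := repeat progress (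
  cbv [tsub1 lam_ use Ext_refl Ext_cons lift ext];
  cbn [tsub scons var_case up_sub tren wk up_ren ids];
  autorewrite with tsub).
Ltac step := first [rewrite beta | rewrite rec0 | rewrite recS
                   | rewrite lrec_nil | rewrite lrec_cons]; tsimp.
(* Only [c] is unfolded: a redex exposed under [Lam] would make [rewrite] diverge. *)
Tactic Notation "compute" "with" reference(c) := unfold c; tsimp; repeat step; reflexivity.

Section Computation.
Context {G : ctx} {H : list (fm G)}.

Lemma len_nil a : eqv H (@len G a · Nil) Zero.
Proof. compute with len. Qed.
Lemma len_cons a x l : eqv H (@len G a · (Cons · x · l)) (Succ · (len · l)).
Proof. compute with len. Qed.
Lemma cat_cons a x l k : eqv H (@cat G a · (Cons · x · l) · k) (Cons · x · (cat · l · k)).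
Proof. compute with cat. Qed.
Lemma take_nil a n : eqv H (@take G a · n · Nil) Nil.
Proof. compute with take. Qed.
Lemma take_0 a x l : eqv H (@take G a · Zero · (Cons · x · l)) Nil.
Proof. compute with take. Qed.
Lemma take_S a n x l :
  eqv H (@take G a · (Succ · n) · (Cons · x · l)) (Cons · x · (take · n · l)).
Proof. compute with take. Qed.
Lemma dbl_0 : eqv H (@dbl G · Zero) Zero.
Proof. compute with dbl. Qed.
Lemma dbl_S n : eqv H (@dbl G · (Succ · n)) (Succ · (Succ · (dbl · n))).
Proof. compute with dbl. Qed.
Lemma code_nil : eqv H (@code G · Nil) Zero.
Proof. compute with code. Qed.
Lemma code_cons_0 l : eqv H (@code G · (Cons · Zero · l)) (Succ · (dbl · (code · l))).
Proof. compute with code. Qed.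
Lemma code_cons_S x l :
  eqv H (@code G · (Cons · (Succ · x) · l)) (dbl · (code · (Cons · x · l))).
Proof. compute with code. Qed.
Lemma inc_head_nil : eqv H (@inc_head G · Nil) Nil.
Proof. compute with inc_head. Qed.
Lemma inc_head_cons x l : eqv H (@inc_head G · (Cons · x · l)) (Cons · (Succ · x) · l).
Proof. compute with inc_head. Qed.
Lemma nxt_nil : eqv H (@nxt G · Nil) (Cons · Zero · Nil).
Proof. compute with nxt. Qed.
Lemma nxt_cons_0 l : eqv H (@nxt G · (Cons · Zero · l)) (inc_head · (nxt · l)).
Proof. compute with nxt. Qed.
Lemma nxt_cons_S x l :
  eqv H (@nxt G · (Cons · (Succ · x) · l)) (Cons · Zero · (Cons · x · l)).
Proof. compute with nxt. Qed.
Lemma decode_0 : eqv H (@decode G · Zero) Nil.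
Proof. compute with decode. Qed.
Lemma decode_S n : eqv H (@decode G · (Succ · n)) (nxt · (decode · n)).
Proof. compute with decode. Qed.
Lemma shift_app f n : eqv H (@shift G · f · n) (f · (Succ · n)).
Proof. compute with shift. Qed.
Lemma monus_0 m : eqv H (@monus G · m · Zero) m.
Proof. compute with monus. Qed.
Lemma monus_S m n : eqv H (@monus G · m · (Succ · n)) (pred_tm · (monus · m · n)).
Proof. compute with monus. Qed.
Lemma pred_0 : eqv H (@pred_tm G · Zero) Zero.
Proof. compute with pred_tm. Qed.
Lemma pred_S n : eqv H (@pred_tm G · (Succ · n)) n.
Proof. compute with pred_tm. Qed.
Lemma tab_S f k :
  eqv H (@tab G N · f · (Succ · k)) (Cons · (f · Zero) · (tab · (shift · f) · k)).
Proof.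
  (* The recursion of [tab] hands on a bare abstraction, which is identified here with
     [shift · f]. *)
  assert (E : eqv H (shift · f) (Lam N (tren f wk · (Succ · v0)))) by compute with shift.
  unfold tab; tsimp; repeat step. now rewrite E.
Qed.
Lemma probe_nil c f : eqv H (@probe G · c · Nil · f) Zero.
Proof. compute with probe. Qed.
Lemma probe_cons c x l f :
  eqv H (@probe G · c · (Cons · x · l) · f)
    (Rec · (f · Zero) · (probe · c · l · (shift · f)) · Lam N (Lam N (tren (tren c wk) wk))).
Proof. compute with probe. Qed.
Lemma probe_assoc_app f c s :
  eqv H (@probe_assoc G · f · c · s) (probe · c · (decode · s) · f).
Proof. compute with probe_assoc. Qed.
Lemma probe_cons_0 c x l f :
  eqv H (f · Zero) Zero ->
  eqv H (@probe G · c · (Cons · x · l) · f) (probe · c · l · (shift · f)).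
Proof. intro e. now rewrite probe_cons, e, rec0. Qed.
Lemma probe_cons_S c x l f m :
  eqv H (f · Zero) (Succ · m) -> eqv H (@probe G · c · (Cons · x · l) · f) c.
Proof. intro e. rewrite probe_cons, e, recS. repeat step. reflexivity. Qed.
End Computation.

(** * Weakening, induction and case distinction inside the theory *)

Lemma weaken G (H K : list (fm G)) p : H ⊢ p -> incl H K -> K ⊢ p.
Proof.
  intro h; revert K. induction h; intros K HK.
  - now apply prf_ax.
  - apply prf_hyp; auto.
  - apply prf_impI, IHh. intros x [<-|i]; [now left|right; auto].
  - eapply prf_impE; eauto.
  - apply prf_andI; auto.
  - eapply prf_andE1; eauto.
  - eapply prf_andE2; eauto.
  - apply prf_orI1; auto.
  - apply prf_orI2; auto.
  - eapply prf_orE; [eauto|apply IHh2|apply IHh3];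
      (intros x [<-|i]; [now left|right; auto]).
  - apply prf_raa, IHh. intros x [<-|i]; [now left|right; auto].
  - apply prf_allI, IHh. now apply incl_map.
  - apply prf_allE; auto.
  - eapply prf_exI; auto.
  - eapply prf_exE; [eauto|apply IHh2].
    intros x [<-|i]; [now left|right; now apply (incl_map fwk HK)].
Qed.

Definition weak1 {G b} : sub G (b :: G) := fun a v => Var (VS v).
Definition weak2 {G b c} : sub G (c :: b :: G) := fun a v => Var (VS (VS v)).

(** The induction axioms mention [p] below a binder as [inst1 p n] with [n] the bound variable; this
    turns that back into [p]. *)
Lemma fsub_scons_wk G b (p : fm (b :: G)) : fsub p (scons v0 weak1) = p.
Proof.
  rewrite <- (fsub_ids p) at 2. f_equal. now apply (cons_funext (P := tm (b :: G))).
Qed.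

Section Induction.
Context {G : ctx} {H : list (fm G)}.

Lemma num_induction (p : fm (N :: G)) :
  internal p -> H ⊢ fsub1 p Zero -> p :: map fwk H ⊢ fsub p (scons (Succ · v0) weak1) ->
  H ⊢ All N p.
Proof.
  intros hp h0 hS.
  pose proof (internal_axiom (H := H) (ax_ind hp)) as A.
  unfold inst1, all_, Ext_refl, Ext_cons, use, ext in A.
  change (fun (c : ty) (v : var G c) => Var (VS v)) with (@weak1 G N) in A.
  rewrite fsub_scons_wk in A.
  apply (prf_impE A), prf_andI; [exact h0|]. now apply prf_allI, prf_impI.
Qed.

Lemma external_induction (p : fm (N :: G)) :
  H ⊢ fsub1 p Zero ->
  p :: St v0 :: map fwk H ⊢ fsub p (scons (Succ · v0) weak1) ->
  H ⊢ All N (St v0 ⟶ p).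
Proof.
  intros h0 hS.
  pose proof (prf_ax (T := P_QF) H (or_introl (ax_ext_ind p))) as A.
  unfold inst1, all_, Ext_refl, Ext_cons, use, ext in A.
  change (fun (c : ty) (v : var G c) => Var (VS v)) with (@weak1 G N) in A.
  rewrite fsub_scons_wk in A.
  apply (prf_impE A), prf_andI; [exact h0|]. now apply prf_allI, prf_impI, prf_impI.
Qed.

Lemma list_cases a (l : tm G (a^*)) (q : fm G) :
  (l ≐ Nil) :: H ⊢ q ->
  (tsub l weak2 ≐ Cons · v1 · v0) :: map fwk (map fwk H) ⊢ fsub q weak2 ->
  H ⊢ q.
Proof.
  intros hn hc. eapply prf_orE; [apply internal_axiom, (ax_seq l)|exact hn|].
  eapply prf_exE; [now apply prf_hyp; left|].
  eapply prf_exE; [now apply prf_hyp; left|].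
  replace (fwk (fwk q)) with (fsub q (@weak2 G a (a^*))) by (symmetry; apply fsub_fsub).
  eapply weaken; [exact hc|]. intros x [<-|i].
  - left. unfold lift, use, Ext_cons, Ext_refl, ext; cbn. now rewrite tren_as_tsub.
  - do 2 right. apply in_map_iff in i as (y & <- & i).
    apply in_map. right. exact i.
Qed.

Lemma fsub_scons D E b (p : fm (b :: G)) (t : tm D b) (s : sub G D) (s' : sub D E) :
  fsub (fsub p (scons t s)) s' = fsub p (scons (tsub t s') (fun c v => tsub (s c v) s')).
Proof. rewrite fsub_fsub. f_equal. now apply (cons_funext (P := tm E)). Qed.

Lemma leibniz_scons D K b (p : fm (b :: D)) (s : sub D G) (t u : tm G b) :
  internal p -> K ⊢ t ≐ u -> K ⊢ fsub p (scons t s) -> K ⊢ fsub p (scons u s).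
Proof.
  intros hp e.
  assert (E : forall w, fsub p (scons w s) = fsub1 (fsub p (up_sub s)) w).
  { intro w. unfold fsub1. rewrite fsub_fsub. f_equal.
    apply (cons_funext (P := tm G)); [reflexivity|]. intros c v; cbn.
    now rewrite tsub_wk_scons, tsub_ids. }
  rewrite !E. apply leibniz; [now apply internal_fsub|exact e].
Qed.

End Induction.

#[local] Arguments fwk {G b} p /.
Ltac hyp := apply prf_hyp; repeat first [left; reflexivity | right].
Ltac pick n :=
  lazymatch n with O => left; reflexivity | S ?m => right; pick m end.
Tactic Notation "use_hyp" constr(n) "as" ident(B) :=
  let K := lazymatch goal with |- prf _ ?K _ => K | |- eqv ?K _ _ => K end in
  eassert (B : prf P_QF K _) by (apply prf_hyp; pick n).
Ltac fsimp := repeat progress (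
  cbv [all_ ex_ fsub1 tsub1 lam_ use Ext_refl Ext_cons lift ext weak1 weak2 Neg];
  cbn [map fwk fsub tsub scons var_case up_sub tren wk up_ren ids];
  autorewrite with tsub).
Ltac fsimp_in B := repeat progress (
  cbv [all_ ex_ fsub1 tsub1 lam_ use Ext_refl Ext_cons lift ext weak1 weak2 Neg] in B;
  cbn [map fwk fsub tsub scons var_case up_sub tren wk up_ren ids] in B;
  autorewrite with tsub in B).

(** Internal induction on the disjunction; in the successor case the induction variable is the
    predecessor. *)
Lemma num_cases G H (n : tm G N) q :
  (n ≐ Zero) :: H ⊢ q ->
  (tsub n weak1 ≐ Succ · v0) :: map fwk H ⊢ fwk q -> H ⊢ q.
Proof.
  intros h0 hS.
  assert (A : H ⊢ All N (v0 ≐ Zero ∨ Ex N (v1 ≐ Succ · v0))).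
  { apply num_induction; [cbn; auto| |].
    - apply prf_orI1, internal_axiom, ax_refl.
    - apply prf_orI2. eapply (prf_exI (t := v0)), internal_axiom, ax_refl. }
  eapply prf_orE; [exact (prf_allE n A)|exact h0|].
  eapply prf_exE; [hyp|]. eapply weaken; [exact hS|].
  intros x [<-|i]; [left|right; now right].
  cbn. now rewrite tren_as_tsub.
Qed.

Lemma succ_absurd G H (n : tm G N) q : eqv H (Succ · n) Zero -> H ⊢ q.
Proof.
  intro e. apply exfalso_rule. exact (prf_impE (internal_axiom (ax_succ_neq0 n)) e).
Qed.

Lemma succ_inj G H (n m : tm G N) : eqv H (Succ · n) (Succ · m) -> eqv H n m.
Proof. intro e. exact (prf_impE (internal_axiom (ax_succ_inj n m)) e). Qed.

(** The axioms offer induction on numbers and the case distinction [ax_seq]. So [p] is proved for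
    all lists of length [n] by induction on [n]: a list of length [Succ n] is a cons whose tail has
    length [n]. *)
Lemma list_induction G H a (p : fm (a^* :: G)) :
  internal p -> H ⊢ fsub1 p Nil ->
  fsub p (scons v0 weak2) :: map fwk (map fwk H) ⊢ fsub p (scons (Cons · v1 · v0) weak2) ->
  H ⊢ All (a^*) p.
Proof.
  intros hp h0 hS.
  (* Base case and step become hypotheses of the object derivation, which keeps them available below
     further binders. *)
  set (step := All a (All (a^*)
    (fsub p (scons v0 weak2) ⟶ fsub p (scons (Cons · v1 · v0) weak2)))).
  apply (cut h0).
  apply (cut (p := step)).
  { eapply weaken; [|now apply incl_tl, incl_refl].
    now apply prf_allI, prf_allI, prf_impI. }
  clear h0 hS.
  set (K := step :: _).
  assert (EK : K = step :: fsub1 p Nil :: H) by reflexivity. clearbody K.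
  assert (A : K ⊢ All N (All (a^*) (len · v0 ≐ v1 ⟶ fsub p (scons v0 weak2)))).
  { apply num_induction.
    - cbn. split; [exact I|]. now apply internal_fsub.
    - rewrite EK; unfold step. apply prf_allI, prf_impI. fsimp. rewrite !fsub_scons.
      apply (list_cases (l := v0)); fsimp; rewrite ?fsub_scons.
      + apply (leibniz_scons (t := Nil)); [exact hp|apply eqv_equiv; hyp|].
        hyp.
      + apply (succ_absurd (n := len · v0)).
        rewrite <- len_cons.
        transitivity (len · v2 : tm (a^* :: a :: a^* :: G) N); [|hyp].
        apply App_proper; [reflexivity|apply eqv_equiv; hyp].
    - rewrite EK; unfold step. apply prf_allI, prf_impI. fsimp. rewrite !fsub_scons.
      apply (list_cases (l := v0)); fsimp; rewrite ?fsub_scons.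
      + apply (succ_absurd (n := v1)).
        transitivity (len · v0 : tm (a^* :: N :: G) N); [apply eqv_equiv; hyp|].
        rewrite <- (len_nil a). apply App_proper; [reflexivity|hyp].
      + cbn. apply (leibniz_scons (t := Cons · v1 · v0)); [exact hp|apply eqv_equiv; hyp|].
        eapply prf_impE.
        * use_hyp 3 as B.
          apply (prf_allE v1) in B. apply (prf_allE v0) in B.
          fsimp_in B. rewrite !fsub_scons in B. cbn in B.
          exact B.
        * use_hyp 2 as B.
          apply (prf_allE v0) in B.
          fsimp_in B. rewrite !fsub_scons in B. cbn in B.
          apply (prf_impE B). apply succ_inj. rewrite <- len_cons.
          transitivity (len · v2 : tm (a^* :: a :: a^* :: N :: G) N); [|hyp].
          apply App_proper; [reflexivity|apply eqv_equiv; hyp]. }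
  apply (cut A). apply prf_allI. clear A. fsimp. rewrite !fsub_scons.
  use_hyp 0 as B.
  (* With the list's own length as [n], the side condition is reflexivity. *)
  apply (prf_allE (len · v0)) in B. apply (prf_allE v0) in B.
  fsimp_in B. rewrite !fsub_scons in B.
  refine (eq_ind _ (prf _ _) (prf_impE B _) _ (fsub_scons_wk p)). apply internal_axiom, ax_refl.
Qed.

Ltac to_eqv := lazymatch goal with |- prf _ ?K (Eq ?t ?u) => change (eqv K t u) end.
Tactic Notation "use_eq" constr(n) "as" ident(E) := use_hyp n as E;
  lazymatch type of E with prf _ ?K (Eq ?t ?u) => change (eqv K t u) in E end.
Ltac mp B :=
  lazymatch type of B with prf ?T ?K (Imp ?p ?q) =>
    let C := fresh in
    assert (C : prf T K p);
      [clear B | let D := fresh in pose proof (prf_impE B C) as D; clear B C; rename D into B]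
  end.
(* Forgets the hypotheses, whose formulas would otherwise be targets of [rewrite]. *)
Ltac seal := try to_eqv;
  let K := lazymatch goal with |- eqv ?K _ _ => K end in
  let K' := fresh "K" in set (K' := K) in *; clearbody K';
  repeat match goal with B : prf _ K' (Eq ?t ?u) |- _ => change (eqv K' t u) in B end.
Ltac introv := apply prf_allI; fsimp.
Ltac introh := apply prf_impI; fsimp.
Tactic Notation "refute" constr(n) := apply exfalso_rule;
  let B := fresh in use_hyp n as B; apply (prf_impE B); clear B; try to_eqv.

(** * Decoding inverts coding *)

(** Under the coding [inc_head] doubles and [nxt] adds one, so both sides have code 2 code l + 1,
    also for [l] empty. *)
Lemma nxt_inc_head G (H : list (fm G)) (l : tm G (N^*)) :
  eqv H (nxt · (inc_head · l)) (Cons · Zero · l).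
Proof.
  apply (list_cases (l := l)); fsimp; use_eq 0 as E; seal; rewrite E.
  - now rewrite inc_head_nil, nxt_nil.
  - now rewrite inc_head_cons, nxt_cons_S.
Qed.

(** Passing from [n] to [Succ n] applies [nxt] twice on the left: the first prepends a zero, the
    second turns this into [inc_head] of [nxt]. *)
Lemma decode_dbl G (H : list (fm G)) (n : tm G N) :
  eqv H (decode · (dbl · n)) (inc_head · (decode · n)).
Proof.
  assert (A : H ⊢ All N (decode · (dbl · v0) ≐ inc_head · (decode · v0))).
  { apply num_induction; fsimp; [exact I| |].
    - to_eqv. now rewrite dbl_0, decode_0, inc_head_nil.
    - use_eq 0 as E. seal.
      now rewrite dbl_S, !decode_S, E, nxt_inc_head, nxt_cons_0. }
  exact (prf_allE n A).
Qed.

(** Induction on [x] follows the factor 2^x of the code: head 0 gives an odd code, and each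
    successor doubles it. *)
Lemma decode_code_cons G (H : list (fm G)) (x : tm G N) (l : tm G (N^*)) :
  eqv H (decode · (code · (Cons · x · l))) (Cons · x · (decode · (code · l))).
Proof.
  assert (A : H ⊢ All (N^*) (All N
     (decode · (code · (Cons · v0 · v1)) ≐ Cons · v0 · (decode · (code · v1))))).
  { introv. apply num_induction; fsimp; [exact I| |].
    - to_eqv. now rewrite code_cons_0, decode_S, decode_dbl, nxt_inc_head.
    - use_eq 0 as E. seal. now rewrite code_cons_S, decode_dbl, E, inc_head_cons. }
  apply (prf_allE l) in A. apply (prf_allE x) in A. fsimp_in A. exact A.
Qed.

Lemma decode_code G (H : list (fm G)) (l : tm G (N^*)) : eqv H (decode · (code · l)) l.
Proof.
  assert (A : H ⊢ All (N^*) (decode · (code · v0) ≐ v0)).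
  { apply list_induction; fsimp; [exact I| |].
    - to_eqv. now rewrite code_nil, decode_0.
    - use_eq 0 as E. seal. now rewrite decode_code_cons, E. }
  exact (prf_allE l A).
Qed.

(** * Behaviour of the scan *)

(** A nonzero result on an initial segment of [l] means that a nonzero value of [f] is met within
    [l], before [k] is reached. [n] and [f] stay general in the induction because both move at each
    step. *)
Lemma probe_cat G (H : list (fm G)) :
  H ⊢ ∀[N] c, ∀[N^*] l, ∀[N] n, ∀[N^*] k, ∀[one] f,
    ¬ probe · c · (take · n · l) · f ≐ Zero ⟶
    probe · c · (cat · l · k) · f ≐ probe · c · l · f.
Proof.
  introv. apply list_induction; fsimp; [cbn; tauto| |]; introv; introv; introv; introh.
  - refute 0. seal. now rewrite take_nil, probe_nil.
  - apply (num_cases (n := v2)); fsimp.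
    + refute 1. use_eq 0 as E. seal. now rewrite E, take_0, probe_nil.
    (* If [f] vanishes at 0, the scan passes to the tail with [shift · f]; otherwise both sides are
       already [c]. *)
    + apply (num_cases (n := v1 · Zero)); fsimp; use_eq 0 as E.
      * use_hyp 3 as B.
        apply (prf_allE v0) in B; apply (prf_allE v2) in B.
        apply (prf_allE (shift · v1)) in B. fsimp_in B.
        mp B.
        { clear E. introh. refute 3.
          use_eq 2 as F. use_eq 1 as E. use_eq 0 as D. seal.
          rewrite F, take_S, (probe_cons_0 _ _ _ E). exact D. }
        seal. now rewrite cat_cons, (probe_cons_0 _ _ _ E), (probe_cons_0 _ _ _ E).
      * seal. now rewrite cat_cons, (probe_cons_S _ _ _ E), (probe_cons_S _ _ _ E).
Qed.

(** Length [Succ m] is what brings the index [m] into the scan. [f] and [b] stay general because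
    [probe] shifts the one and [tab] the other. *)
Lemma probe_tab G (H : list (fm G)) :
  H ⊢ ∀[N] c, ∀[N] m, ∀[one] f, ∀[one] b,
    ¬ f · m ≐ Zero ⟶ probe · c · (tab · b · (Succ · m)) · f ≐ c.
Proof.
  introv. apply num_induction; fsimp; [cbn; tauto| |]; introv; introv; introh;
    apply (num_cases (n := v1 · Zero)); fsimp; use_eq 0 as E.
  - refute 1. exact E.
  - seal. now rewrite tab_S, (probe_cons_S _ _ _ E).
  - use_hyp 2 as B. apply (prf_allE (shift · v1)) in B. apply (prf_allE (shift · v0)) in B.
    fsimp_in B. mp B.
    { clear E. introh. refute 2.
      use_eq 0 as E. seal. now rewrite <- shift_app. }
    seal. rewrite tab_S, (probe_cons_0 _ _ _ E). exact B.
  - seal. now rewrite tab_S, (probe_cons_S _ _ _ E).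
Qed.

(** The recursion can only end in [c] or 0. This fixes a nonzero result without locating the index
    that caused it. *)
Lemma probe_nonzero G (H : list (fm G)) :
  H ⊢ ∀[N] c, ∀[N^*] l, ∀[one] f,
    ¬ probe · c · l · f ≐ Zero ⟶ probe · c · l · f ≐ c.
Proof.
  introv. apply list_induction; fsimp; [cbn; tauto| |]; introv; introh.
  - refute 0. apply probe_nil.
  - apply (num_cases (n := v0 · Zero)); fsimp; use_eq 0 as E.
    + use_hyp 2 as B. apply (prf_allE (shift · v0)) in B. fsimp_in B. mp B.
      { clear E. introh. refute 2.
        use_eq 1 as E. use_eq 0 as D. seal. now rewrite (probe_cons_0 _ _ _ E). }
      seal. rewrite (probe_cons_0 _ _ _ E). exact B.
    + seal. now rewrite (probe_cons_S _ _ _ E).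
Qed.

Lemma st_succ G (H : list (fm G)) (n : tm G N) : H ⊢ St n -> H ⊢ St (Succ · n).
Proof.
  intro h. refine (prf_impE (prf_ax _ (or_introl (ax_st_app _ _))) (prf_andI _ h)).
  exact (prf_ax H (or_introl (ax_st_closed G Succ))).
Qed.

(* By external induction on the length of [l], with [f] generalised since the
   recursion of [probe] shifts it. *)
Lemma probe_standard G (H : list (fm G)) :
  H ⊢ ∀st[N] n, ∀[N^*] l, ∀[one] f, ∀[N] c,
    len · l ≐ n ⟶ (∀st[N] i, f · i ≐ Zero) ⟶ probe · c · l · f ≐ Zero.
Proof.
  cbv [all_ use]. apply external_induction; fsimp; introv; introv; introv; introh; introh;
    apply (list_cases (l := v2)); fsimp; use_eq 0 as E.
  - seal. now rewrite E, probe_nil.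
  - apply (succ_absurd (n := len · v0)). use_eq 2 as F. seal.
    now rewrite <- F, E, len_cons.
  - apply (succ_absurd (n := v3)). use_eq 2 as F. seal. now rewrite <- F, E, len_nil.
  - use_hyp 1 as Z. apply (prf_allE Zero) in Z. fsimp_in Z. mp Z.
    { exact (prf_ax _ (or_introl (ax_st_closed _ Zero))). }
    use_hyp 3 as B. apply (prf_allE v0) in B. apply (prf_allE (shift · v3)) in B.
    apply (prf_allE v2) in B. fsimp_in B.
    mp B; [|mp B].
    + use_eq 2 as F. seal. apply succ_inj. now rewrite <- len_cons, <- E, F.
    (* [shift · f] also vanishes at standard numbers, since successors of standard numbers are
       standard. *)
    + clear E Z. introv. introh. use_hyp 2 as B. apply (prf_allE (Succ · v0)) in B.
      fsimp_in B. mp B; [apply st_succ; hyp|].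
      seal. now rewrite shift_app.
    + seal. rewrite E, probe_cons_0; [exact B|exact Z].
Qed.

(** * The associates built from [probe] *)

Lemma lt_zero_absurd G (H : list (fm G)) t q :
  H ⊢ Zero < t -> eqv H t Zero -> H ⊢ q.
Proof.
  intros h e. apply (succ_absurd (n := Zero)).
  change (eqv H (monus · (Succ · Zero) · t) Zero) in h.
  now rewrite e, monus_0 in h.
Qed.

Tactic Notation "use_lemma" constr(L) "as" ident(B) :=
  let K := lazymatch goal with |- prf _ ?K _ => K end in pose proof (L _ K) as B.
Ltac fsimp_defs :=
  cbv [associate lt_fm initseg initseg_code prefix value_is approx1]; fsimp.

(** Totality comes from [probe_tab], constancy along extensions from [probe_cat]. Being an associate
    is an internal property, so a nonstandard [m] can serve as witness. *)
Lemma probe_assoc_associate G (H : list (fm G)) :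
  H ⊢ ∀[one] f, ∀[N] m, ∀[N] c,
    ¬ f · m ≐ Zero ⟶ (Zero < c) ⟶ associate (probe_assoc · f · c).
Proof.
  fsimp_defs. introv. introv. introv. introh. introh. apply prf_andI.
  (* [v2] is [m], and an initial segment of length m + 1 contains the index [m]. *)
  - introv. apply (prf_exI (t := Succ · v2)). fsimp.
    use_lemma @probe_tab as B.
    apply (prf_allE v1) in B. apply (prf_allE v2) in B. apply (prf_allE v3) in B.
    apply (prf_allE v0) in B. fsimp_in B. mp B; [hyp|].
    use_eq 0 as E. seal.
    rewrite probe_assoc_app, decode_code. rewrite B. exact E.
  - introv. introv. introv. introh.
    (* The prefix relation supplies the remainder of [t] beyond [s], which plays the part of [k] in
       [probe_cat]. *)
    eapply prf_exE; [eapply prf_andE1; hyp|]. fsimp.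
    use_eq 0 as E. use_hyp 1 as D. apply prf_andE2 in D.
    use_lemma @probe_cat as B.
    apply (prf_allE v4) in B. apply (prf_allE (decode · v3)) in B.
    apply (prf_allE v1) in B. apply (prf_allE v0) in B. apply (prf_allE v6) in B.
    fsimp_in B. mp B.
    + clear D E. introh. use_hyp 2 as D. apply prf_andE2 in D.
      eapply lt_zero_absurd; [exact D|]. use_eq 0 as E. seal.
      rewrite probe_assoc_app, decode_code. exact E.
    + seal. now rewrite !probe_assoc_app, <- E, B.
Qed.

(** A positive value of the associate can only be [c], whatever [h] is. Hence the argument in [GH],
    where [Γ] recurs, never has to be evaluated. *)
Lemma value_probe_assoc G (H : list (fm G)) f c h v :
  H ⊢ value_is (probe_assoc · f · c) h v -> H ⊢ v ≐ monus · c · (Succ · Zero).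
Proof.
  assert (A : H ⊢ ∀[one] f, ∀[N] c, ∀[one] h, ∀[N] v,
    value_is (probe_assoc · f · c) h v ⟶ v ≐ monus · c · (Succ · Zero)).
  { fsimp_defs. introv. introv. introv. introv. introh.
    eapply prf_exE; [hyp|]. fsimp.
    use_hyp 0 as D. apply prf_andE1 in D.
    use_hyp 0 as E. apply prf_andE2 in E.
    use_lemma @probe_nonzero as B.
    apply (prf_allE v3) in B. apply (prf_allE (tab · v2 · v0)) in B.
    apply (prf_allE v4) in B. fsimp_in B. mp B.
    - clear D E. introh. use_hyp 1 as D. apply prf_andE1 in D.
      eapply lt_zero_absurd; [exact D|]. use_eq 0 as E. seal.
      rewrite probe_assoc_app, decode_code. exact E.
    - seal.
      now rewrite E, probe_assoc_app, decode_code, B. }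
  intro h0.
  apply (prf_allE f) in A. apply (prf_allE c) in A. apply (prf_allE h) in A.
  apply (prf_allE v) in A.
  cbv [value_is lt_fm initseg] in A. fsimp_in A.
  exact (prf_impE A h0).
Qed.

Lemma st_app G (H : list (fm G)) a b (t : tm G (a ⇒ b)) u :
  H ⊢ St t -> H ⊢ St u -> H ⊢ St (t · u).
Proof.
  intros ht hu.
  exact (prf_impE (prf_ax _ (or_introl (ax_st_app _ _))) (prf_andI ht hu)).
Qed.

(** At a standard code both sides are 0: [len] and [decode] are closed terms, so the decoded length
    is standard and [probe_standard] applies. *)
Lemma probe_assoc_approx G (H : list (fm G)) :
  H ⊢ ∀[one] f, ∀[N] c, ∀[N] d, (∀st[N] i, f · i ≐ Zero) ⟶
    approx1 (probe_assoc · f · c) (probe_assoc · f · d).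
Proof.
  fsimp_defs. introv. introv. introv. introh. introv. introh.
  lazymatch goal with |- prf ?T ?K _ =>
    assert (V : forall c : tm _ N, prf T K (probe_assoc · v3 · c · v0 ≐ Zero)) end.
  { intro c.
    use_lemma @probe_standard as B.
    apply (prf_allE (len · (decode · v0))) in B. fsimp_in B. mp B.
    { repeat apply st_app; [| |hyp].
      - exact (prf_ax _ (or_introl (ax_st_closed _ len))).
      - exact (prf_ax _ (or_introl (ax_st_closed _ decode))). }
    apply (prf_allE (decode · v0)) in B. apply (prf_allE v3) in B. apply (prf_allE c) in B.
    fsimp_in B. mp B; [apply eqv_equiv|]. mp B; [hyp|].
    seal. rewrite probe_assoc_app. exact B. }
  pose proof (V v2) as V1. pose proof (V v1) as V2. clear V. seal. now rewrite V1, V2.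
Qed.

(** * Contradiction from two associates that agree on standard arguments *)

Theorem theorem4p25 :
  proves (theory_union P_system QF_AC_1_0) (Imp GH_a_ns2 Pi01_TRANS).
Proof.
  unfold proves. apply prf_impI. eapply prf_exE; [hyp|].
  set (body := And (St _) _). unfold Pi01_TRANS. fsimp.
  introv. introh. introh. introv. apply prf_raa.
  (* From here [v2] is [Γ], [v1] is the standard [f], and [v0] is [m], with [f m ≠ 0] assumed for
     contradiction. *)
  lazymatch goal with |- prf _ ?L _ => set (K := L) end.
  assert (D : K ⊢ fsub body (fun a v => Var (VS (VS v)))) by hyp.
  cbv [body all_] in D. cbn [fsub] in D. apply prf_andE2 in D.
  pose proof (prf_andE1 D) as DA. pose proof (prf_andE2 D) as DB. clear D.
  (* The value of an associate is one less than its positive entry, so 1 and 2 yield the constant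
     functionals 0 and 1. *)
  pose (c1 := Succ · Zero : tm [N; one; one ⇒ N ⇒ N] N).
  pose (c2 := Succ · (Succ · Zero) : tm [N; one; one ⇒ N ⇒ N] N).
  assert (V : forall c, c = c1 \/ c = c2 ->
    (K ⊢ St (probe_assoc · v1 · c))
    /\ (K ⊢ associate (probe_assoc · v1 · c))
    /\ (K ⊢ v2 · (probe_assoc · v1 · c) · Zero ≐ monus · c · (Succ · Zero))).
  { intros c hc.
    assert (hst : K ⊢ St (probe_assoc · v1 · c)).
    { apply st_app; [apply st_app; [|hyp]|].
      - exact (prf_ax _ (or_introl (ax_st_closed _ probe_assoc))).
      - destruct hc as [-> | ->]; repeat apply st_succ;
          exact (prf_ax _ (or_introl (ax_st_closed _ Zero))). }
    assert (has : K ⊢ associate (probe_assoc · v1 · c)).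
    { pose proof (probe_assoc_associate K) as B.
      apply (prf_allE v1) in B. apply (prf_allE v0) in B. apply (prf_allE c) in B.
      assert (hc' : K ⊢ Zero < c).
      { change (eqv K (monus · (Succ · Zero) · c) Zero). clearbody K.
        destruct hc as [-> | ->]; unfold c1, c2;
          now rewrite ?monus_S, monus_0, ?pred_S, ?pred_0. }
      destruct hc as [-> | ->]; (refine (prf_impE (prf_impE B _) hc'); hyp). }
    repeat split; [exact hst|exact has|].
    apply (prf_allE (probe_assoc · v1 · c)) in DA.
    (* [Zero] codes the empty sequence and is standard, so the second clause on [Γ] applies to it as
       well. *)
    assert (hg : K ⊢ GH v2 (probe_assoc · v1 · c) Zero).
    { destruct hc as [-> | ->];
      exact (prf_allE Zero (prf_impE (prf_impE DA hst) has)). }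
    exact (value_probe_assoc hg). }
  destruct (V c1 (or_introl eq_refl)) as (st1 & as1 & e1).
  destruct (V c2 (or_intror eq_refl)) as (st2 & as2 & e2).
  apply (prf_allE (probe_assoc · v1 · c1)) in DB.
  pose proof (prf_impE DB st1) as D1.
  apply (prf_allE (probe_assoc · v1 · c2)) in D1.
  pose proof (prf_impE (prf_impE (prf_impE D1 st2) as1) as2) as D2.
  apply (prf_allE Zero) in D2.
  assert (ap : K ⊢ approx1 (probe_assoc · v1 · c1) (probe_assoc · v1 · c2)).
  { pose proof (probe_assoc_approx K) as B.
    apply (prf_allE v1) in B. apply (prf_allE c1) in B. apply (prf_allE c2) in B.
    apply (prf_impE B). hyp. }
  assert (e : K ⊢ v2 · (probe_assoc · v1 · c1) · Zero ≐ v2 · (probe_assoc · v1 · c2) · Zero).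
  { refine (prf_impE (prf_impE D2 _) ap).
    exact (prf_ax _ (or_introl (ax_st_closed _ Zero))). }
  (* Equality of the two values of [Γ] computes to 0 = 1. *)
  apply (succ_absurd (n := Zero)).
  change (eqv K (v2 · (probe_assoc · v1 · c1) · Zero) (v2 · (probe_assoc · v1 · c2) · Zero)) in e.
  change (eqv K (v2 · (probe_assoc · v1 · c1) · Zero) (monus · c1 · (Succ · Zero))) in e1.
  change (eqv K (v2 · (probe_assoc · v1 · c2) · Zero) (monus · c2 · (Succ · Zero))) in e2.
  clearbody K. rewrite e1, e2 in e. unfold c1, c2 in e.
  rewrite !monus_S, !monus_0, !pred_S in e. now symmetry.
Qed.
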